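(* Let $X$ and $Y$ be finite sets and let $f:X \times Y \to \{-1,1\}$ be a boolean function whose associated $X \times Y$ matrix $(f(x,y))_{x\in X, y \in Y}$ has rank $r$ over the reals. Then there exists a deterministic two-party communication protocol computing $f$ which uses $O(\sqrt{r} \cdot \log r)$ bits of communication, where the constant implied by the $O(\cdot)$ notation is absolute (independent of $f$, $X$, $Y$ and $r$).
   Context: In the two-party communication model, one player holds $x \in X$, the other holds $y \in Y$, and a deterministic protocol is a fixed sequence of bits exchanged (each bit determined by the sender's input and the previous messages) after which both players know $f(x,y)$; its complexity is the maximum number of bits exchanged over all inputs. The rank of $f$ means the real rank of its $X\times Y$ matrix. *)

(* Defs.v *)
From HB Require Import structures.
From mathcomp Require Import all_boot all_order all_algebra.
From mathcomp Require Import all_classical all_reals all_analysis.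

Set Implicit Arguments.
Unset Strict Implicit.
Unset Printing Implicit Defensive.

Import Order.TTheory GRing.Theory Num.Theory.
Local Open Scope ring_scope.

(** Deterministic two-party protocols. A node of the tree is the list of bits
    exchanged so far; it fixes who speaks next, and the bit sent depends only on
    the sender's own input. If that bit is [true] (resp. [false]) the protocol
    continues with the first (resp. second) subtree. No bit is exchanged at a
    leaf: there each player names a value that depends only on the transcript
    (i.e. the leaf) and on his own input. *)
Inductive protocol (X Y Z : Type) : Type :=
| Leaf (outX : X -> Z) (outY : Y -> Z)
| SendX (bit : X -> bool) (ptrue pfalse : protocol X Y Z)
| SendY (bit : Y -> bool) (ptrue pfalse : protocol X Y Z).

Fixpoint bits (X Y Z : Type) (p : protocol X Y Z) (x : X) (y : Y) : nat :=
  match p with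
  | Leaf _ _ => 0%N
  | SendX b p1 p0 => (bits (if b x then p1 else p0) x y).+1
  | SendY b p1 p0 => (bits (if b y then p1 else p0) x y).+1
  end.

Fixpoint outputs (X Y Z : Type) (p : protocol X Y Z) (x : X) (y : Y) : Z * Z :=
  match p with
  | Leaf oX oY => (oX x, oY y)
  | SendX b p1 p0 => outputs (if b x then p1 else p0) x y
  | SendY b p1 p0 => outputs (if b y then p1 else p0) x y
  end.

Definition computes (X Y Z : Type) (p : protocol X Y Z) (f : X -> Y -> Z) : Prop :=
  forall x y, outputs p x y = (f x y, f x y).

Definition cost (X Y : finType) (Z : Type) (p : protocol X Y Z) : nat :=
  \max_(x : X) \max_(y : Y) bits p x y.

Definition fun_mx (R : Type) (X Y : finType) (f : X -> Y -> R) :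
    'M[R]_(#|X|, #|Y|) :=
  \matrix_(i < #|X|, j < #|Y|) f (enum_val i) (enum_val j).

(* Main.v *)
Require Import Defs.
From HB Require Import structures.
From mathcomp Require Import all_boot all_order all_algebra.
From mathcomp Require Import all_classical all_reals all_analysis.
From mathcomp Require Import perm zify ring lra.

Set Implicit Arguments.
Unset Strict Implicit.
Unset Printing Implicit Defensive.

Import Order.TTheory GRing.Theory Num.Theory.
Local Open Scope ring_scope.

(** Every rank [r] sign matrix factors as [F i j = <u_i, v_j>] with
    [|u_i| <= 1] and [|v_j| = O(sqrt r)]: the vectors come from a D-optimal
    design, i.e. a probability vector [q] almost maximizing [det (V q V^T)].
    By Grothendieck's inequality the discrepancy of [F] is then [Omega(1 / sqrt r)]
    for every weighting of the entries.  Weighting ones and minus ones equally,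
    this gives a subrectangle in which the ratio of minority to majority entries
    has dropped, and the trade-off between this drop and the loss of size lets
    one iterate down to a fraction [1 / (4 r)] of minority entries in a rectangle
    of density [r ^ - O(sqrt r)].  A basis argument extracts from it a rectangle
    of rank one.  By the Frobenius rank inequality a rank one rectangle [A' x B']
    has [rank (A' x B) + rank (A x B') <= r + 1], so peeling such rectangles off
    one after another splits rows and columns into [r ^ O(sqrt r)] classes with all
    blocks of rank at most [(r + 1) / 2].  The players announce their classes and
    recurse; the costs [O(sqrt r * log r)] form a geometric series. *)

(** * Grothendieck's inequality *)

Section Rademacher.
Variables (R : realType) (I : finType).

(** Sign vectors are nested pairs rather than functions, so that sums over them split one coordinate
    at a time and the moments follow by induction on [l]. *)
Fixpoint cube (l : seq I) : finType :=
  if l is _ :: l' then (bool * cube l')%type else unit.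

Fixpoint sgsum (u : I -> R) (l : seq I) : cube l -> R :=
  if l is i :: l' then fun s : bool * cube l' => (-1) ^+ s.1 * u i + sgsum u s.2
  else fun=> 0.

Lemma card_cube l : #|cube l| = (2 ^ size l)%N.
Proof. by elim: l => [|i l IH] /=; rewrite ?card_unit // card_prod card_bool IH expnS. Qed.

Lemma sum_cube_cons i l (F : cube (i :: l) -> R) :
  \sum_s F s = \sum_(s : cube l) (F (true, s) + F (false, s)).
Proof.
rewrite (eq_bigr (fun s : bool * cube l => F (s.1, s.2))); last by case.
rewrite -(pair_big xpredT xpredT (fun b s => F (b, s))) /=.
by rewrite big_bool big_split.
Qed.

(** Cross terms cancel between the two signs of the leading coordinate. Up to the factor
    [2 ^ size l], [sgsum] is thus an isometry from vectors to functions on the cube. *)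
Lemma sgsum_moment2 (u v : I -> R) l :
  \sum_(s : cube l) sgsum u s * sgsum v s
    = (2 ^ size l)%:R * \sum_(i <- l) u i * v i.
Proof.
elim: l => [|i l IH]; first by rewrite big1 ?big_nil ?mulr0 // => s _ /=; rewrite mul0r.
rewrite sum_cube_cons big_cons /=.
under eq_bigr => s _.
  rewrite (_ : _ + _ = 2 * (u i * v i) + 2 * (sgsum u s * sgsum v s)); last by ring.
  over.
rewrite big_split /= -mulr_sumr sumr_const card_cube -mulr_sumr IH expnS natrM.
rewrite -mulr_natr; ring.
Qed.

(** Khintchine's inequality for the fourth moment: odd powers of the new sign cancel, and completing
    the square leaves a nonnegative multiple of [u i ^+ 4] to spare. *)
Lemma sgsum_moment4 (u : I -> R) l :
  \sum_(s : cube l) sgsum u s ^+ 4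
    <= 3 * (2 ^ size l)%:R * (\sum_(i <- l) u i ^+ 2) ^+ 2.
Proof.
elim: l => [|i l IH].
  by rewrite big1 ?big_nil ?expr0n ?mulr0 // => s _ /=; rewrite expr0n.
rewrite sum_cube_cons big_cons /=.
under eq_bigr => s _.
  rewrite (_ : _ + _ = 2 * u i ^+ 4 + 12 * u i ^+ 2 * (sgsum u s * sgsum u s)
                       + 2 * sgsum u s ^+ 4); last by ring.
  over.
rewrite !big_split /= sumr_const -mulr_natr -!mulr_sumr card_cube sgsum_moment2 expnS natrM.
rewrite (eq_bigr (fun i => u i ^+ 2)); last by move=> j _; rewrite expr2.
move: IH; set S := \sum_(i <- l) _; set M := \sum_(s : cube l) _.
have : 0 <= (2 ^ size l)%:R * u i ^+ 4 :> R.
  by rewrite mulr_ge0 // (exprM _ 2 2) sqr_ge0.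
set N := (2 ^ size l)%:R; nra.
Qed.
End Rademacher.

Section Grothendieck.
Variable R : realType.

Definition trunc2 (z : R) : R := if z <= - 2 then - 2 else if z <= 2 then z else 2.

Lemma trunc2_bound z : `|trunc2 z| <= 2.
Proof.
rewrite ler_norml /trunc2; apply/andP.
by case: (leP z (- 2)) => h1; [|case: (leP z 2) => h2]; split; lra.
Qed.

Lemma trunc2_sqr z : trunc2 z ^+ 2 <= z ^+ 2.
Proof. by rewrite /trunc2; case: (leP z (- 2)) => h1; [|case: (leP z 2) => h2]; nra. Qed.

(* The parabola [z ^+ 2 / 8] touches the line [z - 2] at [z = 4]. *)
Lemma trunc2_tail z : (z - trunc2 z) ^+ 2 <= z ^+ 4 / 64.
Proof.
have e : z ^+ 4 / 64 = (z ^+ 2 / 8) ^+ 2 by field.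
rewrite e -real_normK ?num_real // ler_sqr ?nnegrE //; last by nra.
rewrite ler_norml /trunc2; apply/andP; move: (sqr_ge0 (z - 4)) (sqr_ge0 (z + 4)).
by case: (leP z (- 2)) => h1; [|case: (leP z 2) => h2]; split; nra.
Qed.

Variables (m n : nat) (A : 'M[R]_(m, n)) (D : R).
Hypothesis A_sign : forall (s : 'I_m -> bool) (t : 'I_n -> bool),
  \sum_i \sum_j A i j * (-1) ^+ s i * (-1) ^+ t j <= D.

Lemma sum_le_signs k (c p : 'I_k -> R) : (forall i, `|p i| <= 1) ->
  \sum_i c i * p i <= \sum_i c i * (-1) ^+ (c i < 0)%R.
Proof.
move=> hp; apply: ler_sum => i _; move: (hp i); rewrite ler_norml => /andP[h1 h2].
by case: ltP => h; rewrite ?expr1 ?expr0; nra.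
Qed.

(** The form is linear in each argument, so [p] and then [q] can be rounded to signs without
    decreasing it. *)
Lemma bilinear_le_cube (p : 'I_m -> R) (q : 'I_n -> R) :
  (forall i, `|p i| <= 1) -> (forall j, `|q j| <= 1) ->
  \sum_i \sum_j A i j * p i * q j <= D.
Proof.
move=> hp hq.
have -> : \sum_i \sum_j A i j * p i * q j = \sum_i (\sum_j A i j * q j) * p i.
  by apply: eq_bigr => i _; rewrite mulr_suml; apply: eq_bigr => j _; ring.
apply: le_trans (sum_le_signs _ hp) _.
set s := fun i => (\sum_j A i j * q j < 0)%R.
have -> : \sum_i (\sum_j A i j * q j) * (-1) ^+ (\sum_j A i j * q j < 0)%R
    = \sum_j (\sum_i A i j * (-1) ^+ s i) * q j.
  under eq_bigr do rewrite mulr_suml; rewrite exchange_big; apply: eq_bigr => j _.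
  by rewrite mulr_suml; apply: eq_bigr => i _; rewrite /s; ring.
apply: le_trans (sum_le_signs _ hq) _.
apply: le_trans (A_sign s (fun j => \sum_i A i j * (-1) ^+ s i < 0)%R).
by rewrite exchange_big; apply: ler_sum => j _; rewrite mulr_suml.
Qed.

(** The index type [I] is quantified inside because the improvement step trades vectors over [I] for
    functions on a sign cube. *)
Definition gram_bound (B : R) := forall (I : finType) (u : 'I_m -> I -> R) (v : 'I_n -> I -> R),
  (forall i, \sum_k u i k ^+ 2 <= 1) -> (forall j, \sum_k v j k ^+ 2 <= 1) ->
  \sum_i \sum_j A i j * (\sum_k u i k * v j k) <= B.

Lemma gram_bound_trivial : gram_bound (\sum_i \sum_j `|A i j|).
Proof.
move=> I u v hu hv; apply: ler_sum => i _; apply: ler_sum => j _.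
apply: le_trans (ler_norm _) _; rewrite normrM ler_piMr //.
have h x y : `|x * y| <= (x ^+ 2 + y ^+ 2) / 2 :> R.
  rewrite ler_norml; apply/andP; move: (sqr_ge0 (x + y)) (sqr_ge0 (x - y)).
  by split; lra.
apply: le_trans (ler_norm_sum _ _ _) _.
apply: le_trans (ler_sum _ (fun k _ => h _ _)) _.
rewrite -mulr_suml big_split /=; move: (hu i) (hv j); lra.
Qed.

(** Each inner product is the average of [a * b] for two Rademacher sums, split as
    [ta * tb + (a - ta) * tb + a * (b - tb)] with truncations [ta], [tb]. The first term is bounded
    by the sign hypothesis; the other two are again Gram forms, in which one factor has norm at most
    1/4, and each contributes at most [B / 4]. *)
Lemma gram_bound_step B : gram_bound B -> gram_bound (4 * D + B / 2).
Proof.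
move=> HB I u v hu hv.
pose l := index_enum I.
pose N : R := (2 ^ size l)%:R.
have N0 : 0 < N by rewrite ltr0n expn_gt0.
have sN : Num.sqrt N ^+ 2 = N by rewrite sqr_sqrtr // ltW.
have sN0 : 0 < Num.sqrt N by rewrite sqrtr_gt0.
pose a i (s : cube l) := sgsum (u i) s.
pose b j (s : cube l) := sgsum (v j) s.
have m2 w : \sum_k w k ^+ 2 <= 1 -> \sum_(s : cube l) sgsum w s ^+ 2 <= N.
  move=> hw; under eq_bigr do rewrite expr2.
  rewrite sgsum_moment2; under eq_bigr do rewrite -expr2.
  by rewrite -/N ler_piMr // ltW.
have m4 w : \sum_k w k ^+ 2 <= 1 -> \sum_(s : cube l) sgsum w s ^+ 4 <= 3 * N.
  move=> hw; apply: le_trans (sgsum_moment4 _ _) _; rewrite -/N ler_piMr //.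
    by rewrite mulr_ge0 // ltW.
  by rewrite expr_le1 // sumr_ge0 // => k _; rewrite sqr_ge0.
have mt w : \sum_k w k ^+ 2 <= 1 ->
    \sum_(s : cube l) (trunc2 (sgsum w s)) ^+ 2 <= N.
  by move=> hw; apply: le_trans (m2 _ hw); apply: ler_sum => s _; exact: trunc2_sqr.
(* The fourth moment gives [3 / 64 <= 1 / 16]: the part cut off has at most a quarter of the norm
   [Num.sqrt N]. *)
have mr w : \sum_k w k ^+ 2 <= 1 ->
    \sum_(s : cube l) (sgsum w s - trunc2 (sgsum w s)) ^+ 2 <= N / 16.
  move=> hw; apply: (@le_trans _ _ (\sum_(s : cube l) sgsum w s ^+ 4 / 64)).
    by apply: ler_sum => s _; exact: trunc2_tail.
  by rewrite -mulr_suml; move: (m4 _ hw) N0; lra.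
(* The factors [al] and [be] rescale the two families into the unit ball, where [HB] applies; their
   product 4 is the gain. *)
have key (p : 'I_m -> cube l -> R) (q : 'I_n -> cube l -> R) (al be : R) :
    0 < al -> 0 < be -> al * be = 4 ->
    (forall i, al ^+ 2 * \sum_s p i s ^+ 2 <= N) ->
    (forall j, be ^+ 2 * \sum_s q j s ^+ 2 <= N) ->
    \sum_i \sum_j A i j * (\sum_s p i s * q j s) <= N * (B / 4).
  move=> al0 be0 ab hp hq.
  have := HB (cube l) (fun i s => al * p i s / Num.sqrt N)
                      (fun j s => be * q j s / Num.sqrt N).
  have sc (c : R) (w : cube l -> R) : c ^+ 2 * (\sum_s w s ^+ 2) <= N ->
      \sum_s (c * w s / Num.sqrt N) ^+ 2 <= 1.
    move=> h; rewrite (eq_bigr (fun s => c ^+ 2 * w s ^+ 2 / N)); last first.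
      by move=> s _; rewrite !exprMn exprVn sN.
    by rewrite -mulr_suml -mulr_sumr ler_pdivrMr // mul1r.
  move=> /(_ (fun i => sc _ _ (hp i)) (fun j => sc _ _ (hq j))).
  have -> : \sum_i \sum_j A i j * (\sum_s (al * p i s / Num.sqrt N) * (be * q j s / Num.sqrt N))
      = (4 / N) * \sum_i \sum_j A i j * (\sum_s p i s * q j s).
    rewrite mulr_sumr; apply: eq_bigr => i _; rewrite mulr_sumr; apply: eq_bigr => j _.
    rewrite mulrCA; congr (_ * _); rewrite mulr_sumr; apply: eq_bigr => s _.
    have -> : 4 / N = al * be / Num.sqrt N ^+ 2 by rewrite ab sN.
    by field; rewrite lt0r_neq0.
  by rewrite mulrAC ler_pdivrMr //; lra.
pose ta i s := trunc2 (a i s). pose tb j s := trunc2 (b j s).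
have E : \sum_i \sum_j A i j * (\sum_k u i k * v j k)
   = N^-1 * ((\sum_s \sum_i \sum_j A i j * ta i s * tb j s)
      + \sum_i \sum_j A i j * (\sum_s (a i s - ta i s) * tb j s)
      + \sum_i \sum_j A i j * (\sum_s a i s * (b j s - tb j s))).
  have -> : \sum_s \sum_i \sum_j A i j * ta i s * tb j s
      = \sum_i \sum_j A i j * (\sum_s ta i s * tb j s).
    rewrite exchange_big; apply: eq_bigr => i _ /=.
    rewrite exchange_big; apply: eq_bigr => j _ /=.
    by rewrite mulr_sumr; apply: eq_bigr => s _; rewrite mulrA.
  rewrite -!big_split mulr_sumr; apply: eq_bigr => i _ /=.
  rewrite -!big_split mulr_sumr; apply: eq_bigr => j _ /=.
  rewrite -!mulrDr mulrCA; congr (_ * _).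
  rewrite -!big_split /= (eq_bigr (fun s => a i s * b j s)); last by move=> s _ /=; ring.
  by rewrite sgsum_moment2 -/N mulrA mulVf ?mul1r // lt0r_neq0.
rewrite E ler_pdivrMl //.
have h1 : \sum_s \sum_i \sum_j A i j * ta i s * tb j s <= N * (4 * D).
  have -> : N * (4 * D) = \sum_(s : cube l) (4 * D).
    by rewrite sumr_const card_cube -[RHS]mulr_natl.
  apply: ler_sum => s _.
  have hh z : `|trunc2 z / 2| <= 1.
    have := trunc2_bound z; rewrite !ler_norml => /andP[? ?].
    by apply/andP; split; lra.
  have := bilinear_le_cube (fun i => hh (a i s)) (fun j => hh (b j s)).
  have -> : \sum_i \sum_j A i j * (trunc2 (a i s) / 2) * (trunc2 (b j s) / 2)
     = (\sum_i \sum_j A i j * ta i s * tb j s) / 4.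
    rewrite mulr_suml; apply: eq_bigr => i _; rewrite mulr_suml; apply: eq_bigr => j _.
    by rewrite /ta /tb /=; field.
  by rewrite ler_pdivrMr // mulrC.
have h2 : \sum_i \sum_j A i j * (\sum_s (a i s - ta i s) * tb j s) <= N * (B / 4).
  apply: (key _ _ 4 1); rewrite ?mulr1 //; [move=> i|move=> j].
    by have := mr _ (hu i); rewrite /ta /a; lra.
  by rewrite expr1n mul1r; exact: mt.
have h3 : \sum_i \sum_j A i j * (\sum_s a i s * (b j s - tb j s)) <= N * (B / 4).
  apply: (key _ _ 1 4); rewrite ?mul1r //; [move=> i|move=> j].
    by rewrite expr1n mul1r; exact: m2.
  by have := mr _ (hv j); rewrite /tb /b; lra.
by move: h1 h2 h3; lra.
Qed.

(** [8 * D] is the fixed point of [B |-> 4 * D + B / 2]; iterating from the trivial bound halves the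
    error each time. *)
Lemma grothendieck : gram_bound (8 * D).
Proof.
pose B0 := \sum_i \sum_j `|A i j|.
have hk k : gram_bound (8 * D + B0 / 2 ^+ k).
  have D0 : 0 <= D.
    have := @bilinear_le_cube (fun=> 0) (fun=> 0).
    rewrite big1 => [|i _]; first by apply=> ?; rewrite normr0.
    by rewrite big1 // => j _; rewrite !mulr0.
  elim: k => [|k IH] I u v hu hv.
    by have := gram_bound_trivial hu hv; rewrite expr0 divr1 -/B0; lra.
  have := gram_bound_step IH hu hv; rewrite exprS invfM.
  by set z := _ ^-1; lra.
move=> I u v hu hv; apply/ler_addgt0Pr => e e0.
pose k := (Num.truncn (B0 / e)).+1.
apply: le_trans (hk k _ _ _ hu hv) _; rewrite lerD2l.
have h : B0 / e < 2 ^+ k.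
  apply: lt_trans (truncnS_gt _) _; rewrite -natrX ltr_nat.
  exact: ltn_expl.
by rewrite ler_pdivrMr ?exprn_gt0 // -ler_pdivrMl // mulrC ltW.
Qed.
End Grothendieck.

(** * Nearly D-optimal designs *)

(** Both products in [E] factor the block matrix with rows [(1, - w)] and [(z, 1)]; comparing
    determinants gives the identity. *)
Lemma det_1Dmul (R : comPzRingType) (r : nat) (w : 'cV[R]_r) (z : 'rV[R]_r) :
  \det (1%:M + w *m z) = 1 + (z *m w) 0 0.
Proof.
have E : block_mx 1%:M (- w) 0 1%:M *m block_mx (1%:M + w *m z) 0 z 1%:M
       = block_mx 1%:M 0 z (1%:M + z *m w) *m block_mx 1%:M (- w) 0 (1%:M : 'M[R]_1).
  rewrite !mulmx_block !mul1mx !mul0mx !mulmx0 !mulmx1 !addr0 !add0r.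
  rewrite mulNmx addrK mulmxN; congr (block_mx _ _ _ _).
  by rewrite addrC addrK.
have := congr1 determinant E; rewrite !det_mulmx !det_lblock !det_ublock !det1.
by rewrite !mul1r !mulr1 => ->; rewrite det_mx11 !mxE.
Qed.

Lemma bernoulli_sub (R : realFieldType) (b : R) n :
  0 <= b <= 1 -> 1 - n%:R * b <= (1 - b) ^+ n.
Proof.
move=> /andP[b0 b1]; elim: n => [|n IH]; first by rewrite mul0r subr0.
rewrite exprS -natr1.
have : 0 <= n%:R * b by rewrite mulr_ge0.
by move: IH; set e := _ ^+ n; nra.
Qed.

(** An algebraic form of the exponential decay of [(1 - b) ^+ n], used both for the density
    increment and for counting peeling rounds. *)
Lemma bernoulli_inv (R : realFieldType) (b : R) n :
  0 <= b <= 1 -> (1 - b) ^+ n * (1 + n%:R * b) <= 1.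
Proof.
move=> /andP[b0 b1]; elim: n => [|n IH]; first by rewrite mul0r addr0 mulr1.
rewrite exprS -natr1.
have e0 : 0 <= (1 - b) ^+ n by rewrite exprn_ge0 // subr_ge0.
have n0 : 0 <= n%:R :> R by [].
apply: le_trans IH; move: e0; set e := _ ^+ n => e0.
rewrite mulrAC mulrC ler_wpM2l //.
have : 0 <= n%:R * b ^+ 2 by rewrite mulr_ge0 ?sqr_ge0.
nra.
Qed.

Section Design.
Variables (R : realType) (r n : nat) (V : 'M[R]_(r, n)).

Definition simplex (q : 'rV[R]_n) := (forall j, 0 <= q 0 j) /\ \sum_j q 0 j = 1.
Definition moment (q : 'rV[R]_n) := V *m diag_mx q *m V^T.

(** Shifting weight to one column changes the moment matrix, up to scaling, by a rank one term, so
    [det_1Dmul] gives the new determinant. *)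
Lemma moment_mix (q : 'rV[R]_n) (a b : R) k :
  moment (a *: q + b *: delta_mx 0 k) = a *: moment q + b *: (col k V *m (col k V)^T).
Proof.
rewrite /moment linearD /= !linearZ /= mulmxDr mulmxDl -!scalemxAr -!scalemxAl.
congr (_ + _ *: _).
rewrite colE trmx_mul mulmxA -(mulmxA _ _ (delta_mx k 0)^T) trmx_delta mul_delta_mx.
congr (_ *m _ *m _); apply/matrixP => i j; rewrite !mxE.
have [<-|/negPf ij] := eqVneq i j; rewrite ?mulr1n ?mulr0n.
  by rewrite eqxx andbb.
by case: (eqVneq i k) => //= <-; rewrite eq_sym ij.
Qed.

Lemma simplex_mix q (b : R) k : 0 <= b <= 1 -> simplex q ->
  simplex ((1 - b) *: q + b *: delta_mx 0 k).
Proof.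
move=> /andP[b0 b1] [q0 q1]; split=> [j|].
  by rewrite !mxE addr_ge0 // mulr_ge0 ?subr_ge0 ?ler0n.
under eq_bigr do rewrite !mxE eqxx /=.
rewrite big_split /= -!mulr_sumr q1 (bigD1 k) //= big1 ?eqxx.
  by rewrite addr0 !mulr1 subrK.
by move=> i /negPf ->.
Qed.

Lemma momentE q i j : moment q i j = \sum_k q 0 k * (V i k * V j k).
Proof.
by rewrite /moment mul_mx_diag !mxE; apply: eq_bigr => k _; rewrite !mxE; ring.
Qed.

(** Entries of the moment matrix are averages of products of entries of [V], so the Leibniz formula
    bounds the determinant uniformly and its supremum exists. *)
Lemma moment_det_bounded :
  exists B, forall q, simplex q -> \det (moment q) <= B.
Proof.
pose c := \sum_i \sum_j `|V i j|.
have Vc i j : `|V i j| <= c.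
  rewrite /c (bigD1 i) //= (bigD1 j) //= -addrA lerDl addr_ge0 ?sumr_ge0 // => k _.
  by rewrite sumr_ge0.
exists (\sum_(s : 'S_r) \prod_(i < r) c ^+ 2) => q [q0 q1].
apply: ler_sum => s _; apply: le_trans (ler_norm _) _.
rewrite normrM normrX normrN1 expr1n mul1r normr_prod; apply: ler_prod => i _.
rewrite normr_ge0 /= momentE.
apply: le_trans (ler_norm_sum _ _ _) _.
rewrite -[c ^+ 2]mul1r -q1 mulr_suml; apply: ler_sum => j _.
rewrite !normrM (ger0_norm (q0 j)).
by rewrite expr2 ler_wpM2l ?ler_pM.
Qed.

Hypothesis r_gt0 : (0 < r)%N.
Hypothesis V_free : row_free V.

(** Take the uniform distribution on [r] independent columns of [V]: the moment matrix is then a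
    positive multiple of [B^T *m B] with [B] invertible. *)
Lemma moment_det_gt0 : exists2 q, simplex q & 0 < \det (moment q).
Proof.
have /maxrowsub_full full : row_full V^T by rewrite /row_full mxrank_tr.
have e : \rank V^T = r by rewrite mxrank_tr; apply/eqP.
move: full; move: (maxrankfun _); rewrite e => g full.
set B := rowsub g V^T in full.
have Bu : \det B != 0 by rewrite -unitfE -unitmxE -row_full_unit.
pose q : 'rV[R]_n := \row_j \sum_(k < r) r%:R^-1 * (j == g k)%:R.
have sumq (c : 'I_n -> R) : \sum_j q 0 j * c j = \sum_(k < r) r%:R^-1 * c (g k).
  under eq_bigr do rewrite mxE mulr_suml.
  rewrite exchange_big; apply: eq_bigr => k _.
  rewrite (bigD1 (g k)) //= eqxx mulr1 big1 ?addr0 // => j /negPf ->.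
  by rewrite mulr0 mul0r.
exists q.
  split=> [j|].
    by rewrite mxE sumr_ge0 // => k _; rewrite mulr_ge0 ?invr_ge0 ?ler0n.
  under eq_bigr do rewrite -[q 0 _]mulr1; rewrite sumq sumr_const card_ord.
  by rewrite mulr1 -[_^-1 *+ _]mulr_natr mulVf // pnatr_eq0 -lt0n.
have -> : moment q = r%:R^-1 *: (B^T *m B).
  apply/matrixP => i j; rewrite momentE sumq !mxE mulr_sumr.
  by apply: eq_bigr => k _; rewrite !mxE.
rewrite detZ det_mulmx det_tr -expr2; apply: mulr_gt0.
  by rewrite exprn_gt0 ?invr_gt0 ?ltr0n.
by rewrite exprn_even_gt0.
Qed.

(* A design within a factor two of the maximal determinant is enough, so no
   compactness is needed. *)
Lemma near_optimal_design : exists q, [/\ simplex q, moment q \in unitmx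
  & forall k, ((col k V)^T *m invmx (moment q) *m col k V) 0 0 <= (8 * r)%:R].
Proof.
have [q0 q0s q0d] := moment_det_gt0.
have [B hB] := moment_det_bounded.
pose S : set R := [set x | exists2 q, simplex q & x = \det (moment q)]%classic.
have S0 : (S !=set0)%classic by exists (\det (moment q0)), q0.
have Sub : has_ubound S by exists B => x [q hq ->]; exact: hB.
have supP : 0 < sup S.
  by apply: lt_le_trans q0d _; apply: ub_le_sup => //; exists q0.
have [x [q qs ->] hq] : exists2 y, S y & sup S / 2 < y.
  by apply: sup_gt => //; rewrite ltr_pdivrMr //; lra.
have qd : 0 < \det (moment q) by apply: lt_trans hq; rewrite divr_gt0.
have qu : moment q \in unitmx by rewrite unitmxE unitfE lt0r_neq0.
exists q; split=> // k.
set w := col k V; set s := (_ *m _) 0 0.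
rewrite leNgt; apply/negP => hs.
have rp : 0 < r%:R :> R by rewrite ltr0n.
have r1 : 1 <= r%:R :> R by rewrite ler1n.
(* Moving mass [b] to column [k] multiplies the determinant by [a ^+ r.-1 * (a + b * s)]. With this
   [b] the power is at least 1/2, while [s > 8 * r] gives [b * s > 4]; the determinant would more
   than double and exceed the supremum. *)
pose b : R := (2 * r%:R)^-1.
have rb : r%:R * b = 1 / 2 by rewrite /b; field; rewrite lt0r_neq0.
have b0 : 0 < b by rewrite invr_gt0 mulr_gt0.
have b1 : b <= 1 / 2 by rewrite -rb ler_peMl // ltW.
have q's : simplex ((1 - b) *: q + b *: delta_mx 0 k).
  by apply: simplex_mix => //; lra.
have : \det (moment ((1 - b) *: q + b *: delta_mx 0 k)) <= sup S.
  by apply: ub_le_sup => //; exists ((1 - b) *: q + b *: delta_mx 0 k).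
rewrite moment_mix -/w.
set a := 1 - b; have a0 : a != 0 by rewrite lt0r_neq0 // /a; lra.
have -> : a *: moment q + b *: (w *m w^T)
    = (a *: moment q) *m (1%:M + (invmx (moment q) *m w) *m ((b / a) *: w^T)).
  rewrite mulmxDr mulmx1 -!scalemxAl -!scalemxAr scalerA mulrCA divff // mulr1.
  by rewrite -[_ *m w *m _]mulmxA mulKVmx.
rewrite det_mulmx detZ det_1Dmul -scalemxAl mulmxA mxE -/s.
have bern : 1 / 2 <= a ^+ r.-1.
  apply: le_trans (bernoulli_sub _ _); last by lra.
  have : r.-1%:R <= r%:R :> R by rewrite ler_nat leq_pred.
  by move: rb b0; nra.
rewrite -[in a ^+ r](prednK r_gt0) exprS.
have -> : a * a ^+ r.-1 * \det (moment q) * (1 + b / a * s)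
  = a ^+ r.-1 * (a + b * s) * \det (moment q) by field.
apply/negP; rewrite -ltNge.
have : 4 < b * s.
  have : b * (8 * r)%:R < b * s by rewrite ltr_pM2l.
  by rewrite natrM mulrCA (mulrC b) rb; lra.
move=> bs; have a2 : 2 <= a ^+ r.-1 * (a + b * s).
  have : 1 / 2 <= a by rewrite /a; lra.
  by move: bern bs; set e := a ^+ _; nra.
by move: a2 qd; set e := _ * (a + _); nra.
Qed.
End Design.

(** * Discrepancy *)

Lemma N1_eq1F (R : numDomainType) : (-1 == 1 :> R) = false.
Proof. by rewrite eq_sym -subr_eq0 opprK paddr_eq0 // oner_eq0. Qed.

Section Discrepancy.
Variables (R : realType) (m n : nat) (F : 'M[R]_(m, n)).
Hypothesis F_le1 : forall i j, `|F i j| <= 1.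

Lemma rank_factorization : (0 < \rank F)%N ->
  exists (u : 'I_m -> 'I_n -> R) (v : 'I_n -> 'I_n -> R),
  [/\ forall i, \sum_k u i k ^+ 2 <= 1,
      forall j, \sum_k v j k ^+ 2 <= (8 * \rank F)%:R
    & forall i j, F i j = \sum_k u i k * v j k].
Proof.
move=> r0.
have [U [V [FUV Vfree]]] : exists (U : 'M[R]_(m, \rank F)) V, F = U *m V /\ row_free V.
  by exists (col_base F), (row_base F); rewrite mulmx_base row_base_free.
have [q [[q0 q1] Mu hq]] := near_optimal_design r0 Vfree.
set M := moment V q in Mu hq.
pose W := V^T *m invmx M *m V.
have We k j : W k j = ((col k V)^T *m invmx M *m col j V) 0 0.
  rewrite /W !mxE; apply: eq_bigr => l _; rewrite !mxE; congr (_ * _).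
  by apply: eq_bigr => l' _; rewrite !mxE.
have sq k : Num.sqrt (q 0 k) ^+ 2 = q 0 k by rewrite sqr_sqrtr.
have MW : V *m diag_mx q *m W = V.
  by rewrite /W !mulmxA -/(moment V q) mulmxV // mul1mx.
have FW : F *m diag_mx q *m W = F by rewrite [in LHS]FUV -mulmxA -mulmxA (mulmxA V) MW.
have WW : W^T *m diag_mx q *m W = W^T.
  have {1}-> : W^T = V^T *m (invmx M)^T *m V by rewrite /W !trmx_mul trmxK mulmxA.
  by rewrite -mulmxA -mulmxA (mulmxA V) MW /W !trmx_mul trmxK mulmxA.
exists (fun i k => Num.sqrt (q 0 k) * F i k), (fun j k => Num.sqrt (q 0 k) * W k j).
split=> [i|j|i j].
- rewrite -q1; apply: ler_sum => k _; rewrite exprMn sq ler_piMr //.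
  by rewrite -real_normK ?num_real // expr_le1.
- rewrite (_ : \sum_k _ = W^T j j); first by rewrite mxE We; exact: hq.
  rewrite -{1}WW !mxE; apply: eq_bigr => k _.
  by rewrite mul_mx_diag !mxE exprMn sq; ring.
- rewrite -{1}FW !mxE; apply: eq_bigr => k _.
  by rewrite mul_mx_diag !mxE -{1}(sq k); ring.
Qed.

Lemma discrepancy_bound (A : 'M[R]_(m, n)) (D : R) (r : nat) :
  (\rank F <= r)%N -> 0 <= D ->
  (forall (s : 'I_m -> bool) (t : 'I_n -> bool),
    \sum_i \sum_j A i j * (-1) ^+ s i * (-1) ^+ t j <= D) ->
  \sum_i \sum_j A i j * F i j <= 24 * Num.sqrt r%:R * D.
Proof.
move=> rr D0 hD; have [F0|r0] := posnP (\rank F).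
  move/eqP: F0; rewrite mxrank_eq0 => /eqP->.
  rewrite big1 ?mulr_ge0 ?sqrtr_ge0 // => i _.
  by rewrite big1 // => j _; rewrite mxE mulr0.
have [u [v [hu hv Fe]]] := rank_factorization r0.
have s0 : 0 < Num.sqrt r%:R :> R by rewrite sqrtr_gt0 ltr0n (leq_trans r0).
(* As [8 <= 3 ^ 2], dividing by [c] brings every [v j] into the unit ball; the final constant is
   [24 = 8 * 3]. *)
pose c : R := 3 * Num.sqrt r%:R.
have c0 : 0 < c by rewrite mulr_gt0.
have := grothendieck hD hu (v := fun j k => v j k / c).
have -> : \sum_i \sum_j A i j * (\sum_k u i k * (v j k / c))
   = (\sum_i \sum_j A i j * F i j) / c.
  rewrite mulr_suml; apply: eq_bigr => i _; rewrite mulr_suml; apply: eq_bigr => j _.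
  rewrite -mulrA; congr (_ * _); rewrite Fe mulr_suml.
  by apply: eq_bigr => k _; rewrite mulrA.
rewrite ler_pdivrMr // (_ : 8 * D * c = 24 * Num.sqrt r%:R * D); last by rewrite /c; ring.
apply=> j; under eq_bigr do rewrite exprMn.
rewrite -mulr_suml exprVn ler_pdivrMr ?exprn_gt0 // mul1r.
apply: le_trans (hv j) _; rewrite /c exprMn sqr_sqrtr // natrM.
have : (\rank F)%:R <= r%:R :> R by rewrite ler_nat.
have : 0 <= r%:R :> R by [].
lra.
Qed.

End Discrepancy.

(** * Unbalanced subrectangles of a sign matrix *)

Section SignMatrix.
Variables (R : realType) (m n : nat) (F : 'M[R]_(m, n)).
Hypothesis F_sign : forall i j, F i j = -1 \/ F i j = 1.

(** Submatrices are padded with zeros, so all rectangles share one matrix type while the rank is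
    that of the submatrix. *)
Definition mask (A : {set 'I_m}) (B : {set 'I_n}) : 'M[R]_(m, n) :=
  \matrix_(i, j) (F i j * ((i \in A) && (j \in B))%:R).

Definition rsum (W : 'I_m -> 'I_n -> R) (A : {set 'I_m}) (B : {set 'I_n}) : R :=
  \sum_i \sum_j W i j * ((i \in A) && (j \in B))%:R.

Definition cnt (c : R) := rsum (fun i j => (F i j == c)%:R).

Lemma mask_le1 A B i j : `|mask A B i j| <= 1.
Proof.
rewrite mxE; case: (_ && _); last by rewrite mulr0 normr0.
by rewrite mulr1; case: (F_sign i j) => ->; rewrite ?normrN normr1.
Qed.

Lemma rsum_ge0 W A B : (forall i j, 0 <= W i j) -> 0 <= rsum W A B.
Proof.
by move=> h; apply: sumr_ge0 => i _; apply: sumr_ge0 => j _; rewrite mulr_ge0.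
Qed.

Lemma cnt_ge0 c A B : 0 <= cnt c A B.
Proof. by apply: rsum_ge0. Qed.

(** The signs cut [A] and [B] in two; the product of signs is 1 on the two diagonal quadrants and -1
    on the others. *)
Lemma rsum_signs W (A : {set 'I_m}) (B : {set 'I_n}) (s : 'I_m -> bool) (t : 'I_n -> bool) :
  \sum_i \sum_j (W i j * ((i \in A) && (j \in B))%:R) * (-1) ^+ s i * (-1) ^+ t j
  = 2 * (rsum W [set i in A | ~~ s i] [set j in B | ~~ t j]
         + rsum W [set i in A | s i] [set j in B | t j]) - rsum W A B.
Proof.
rewrite /rsum -big_split mulr_sumr -sumrB; apply: eq_bigr => i _ /=.
rewrite -big_split mulr_sumr -sumrB; apply: eq_bigr => j _ /=.
rewrite !inE; case: (i \in A); case: (j \in B); case: (s i); case: (t j) => /=;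
  rewrite ?expr0 ?expr1; ring.
Qed.

(** The weight [W] gives total mass 1 to the ones and -1 to the minus ones, so it has sum 0 and
    correlation 2 with [F]. By the discrepancy bound some signs achieve more than [4 / K]; as the
    total vanishes, the two diagonal quadrants together weigh more than [2 / K], and one of them at
    least [1 / K]. *)
Lemma rectangle_step (r K : nat) (A : {set 'I_m}) (B : {set 'I_n}) :
  (\rank (mask A B) <= r)%N -> 48 * Num.sqrt r%:R < K%:R :> R ->
  0 < cnt 1 A B -> 0 < cnt (-1) A B ->
  exists (A' : {set 'I_m}) (B' : {set 'I_n}), [/\ A' \subset A, B' \subset B &
    K%:R^-1 <= cnt 1 A' B' / cnt 1 A B - cnt (-1) A' B' / cnt (-1) A B].
Proof.
move=> rr hK P0 N0; set P := cnt 1 A B in P0 *; set N := cnt (-1) A B in N0 *.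
have K0 : 0 < K%:R :> R by apply: le_lt_trans hK; rewrite mulr_ge0 ?sqrtr_ge0.
pose W i j : R := (F i j == 1)%:R / P - (F i j == -1)%:R / N.
have rW A' B' : rsum W A' B' = cnt 1 A' B' / P - cnt (-1) A' B' / N.
  rewrite /cnt /rsum !mulr_suml -sumrB; apply: eq_bigr => i _.
  by rewrite !mulr_suml -sumrB; apply: eq_bigr => j _; rewrite /W; ring.
have W0 : rsum W A B = 0 by rewrite rW !divff ?subrr // lt0r_neq0.
have [s [t hst]] : exists (s : 'I_m -> bool) (t : 'I_n -> bool), 4 / K%:R <
    \sum_i \sum_j (W i j * ((i \in A) && (j \in B))%:R) * (-1) ^+ s i * (-1) ^+ t j.
  apply: contrapT => hno.
  pose W' := \matrix_(i, j) (W i j * ((i \in A) && (j \in B))%:R).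
  have := @discrepancy_bound _ _ _ _ (mask_le1 A B) W' (4 / K%:R) r rr.
  have -> : \sum_i \sum_j W' i j * mask A B i j = 2.
    have -> : 2 = cnt 1 A B / P + cnt (-1) A B / N by rewrite !divff // lt0r_neq0.
    rewrite /cnt /rsum !mulr_suml -big_split; apply: eq_bigr => i _ /=.
    rewrite !mulr_suml -big_split; apply: eq_bigr => j _ /=.
    rewrite !mxE /W; case: (_ && _); last by rewrite !(mulr0, mul0r) addr0.
    by case: (F_sign i j) => ->; rewrite eqxx ?N1_eq1F ?(eq_sym 1) ?N1_eq1F /=; ring.
  move=> h; have : 2 <= 24 * Num.sqrt r%:R * (4 / K%:R) :> R.
    apply: h; first by rewrite divr_ge0.
    move=> s t; rewrite leNgt; apply/negP => hst; apply: hno; exists s, t.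
    apply: lt_le_trans hst _; apply: ler_sum => i _; apply: ler_sum => j _.
    by rewrite mxE.
  by rewrite mulrA ler_pdivlMr //; lra.
move: hst; rewrite (rsum_signs W) W0.
set p := rsum _ _ _; set q := rsum _ _ _ => hst.
have [h|h] : K%:R^-1 <= p \/ K%:R^-1 <= q.
  by case: (leP K%:R^-1 p) => h; [left|right; lra].
- exists [set i in A | ~~ s i], [set j in B | ~~ t j].
  by rewrite -rW; split => //; apply/fintype.subsetP => x; rewrite inE => /andP[].
- exists [set i in A | s i], [set j in B | t j].
  by rewrite -rW; split => //; apply/fintype.subsetP => x; rewrite inE => /andP[].
Qed.

End SignMatrix.

(** * Large rectangles of rank one *)

Lemma sub_mask_rank (R : realType) (m n : nat) (F : 'M[R]_(m, n))
    (A A' : {set 'I_m}) (B B' : {set 'I_n}) :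
  A' \subset A -> B' \subset B -> (\rank (mask F A' B') <= \rank (mask F A B))%N.
Proof.
move=> sA sB.
pose E k (C : {set 'I_k}) : 'M[R]_k := diag_mx (\row_i (i \in C)%:R).
have -> : mask F A' B' = E _ A' *m mask F A B *m E _ B'.
  apply/matrixP => i j; rewrite mul_mx_diag mul_diag_mx !mxE.
  move: (fintype.subsetP sA i) (fintype.subsetP sB j).
  by case: (i \in A') => [/(_ isT) ->|_]; case: (j \in B') => [/(_ isT) ->|_];
    rewrite /= ?mulr1 ?mul1r ?mulr0 ?mul0r.
exact: leq_trans (mxrankM_maxl _ _) (mxrankM_maxr _ _).
Qed.

(** Restricting rows or columns is multiplication by a 0/1 diagonal matrix, so this is the Frobenius
    rank inequality. *)
Lemma mask_Frobenius (R : realType) (m n : nat) (F : 'M[R]_(m, n))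
    (A A' : {set 'I_m}) (B B' : {set 'I_n}) :
  A' \subset A -> B' \subset B ->
  (\rank (mask F A' B) + \rank (mask F A B')
     <= \rank (mask F A B) + \rank (mask F A' B'))%N.
Proof.
move=> sA sB.
pose E k (C : {set 'I_k}) : 'M[R]_k := diag_mx (\row_i (i \in C)%:R).
have e1 : mask F A' B = E _ A' *m mask F A B.
  apply/matrixP => i j; rewrite mul_diag_mx !mxE.
  have := fintype.subsetP sA i.
  by case: (i \in A') => [/(_ isT) ->|_]; rewrite /= ?mul1r ?mul0r ?mulr0.
have e2 C : mask F C B' = mask F C B *m E _ B'.
  apply/matrixP => i j; rewrite mul_mx_diag !mxE.
  have := fintype.subsetP sB j.
  by case: (j \in B') => [/(_ isT) ->|_]; rewrite /= ?andbF ?mulr1 ?mulr0.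
by rewrite !e2 e1; exact: mxrank_Frobenius.
Qed.

Lemma mask_tr (R : realType) (m n : nat) (F : 'M[R]_(m, n))
    (A : {set 'I_m}) (B : {set 'I_n}) :
  mask F^T B A = (mask F A B)^T.
Proof. by apply/matrixP => i j; rewrite !mxE andbC. Qed.

(** Every row is a combination of a maximal independent family of rows, so two columns that agree on
    that family agree on all of [A]. *)
Lemma mask_row_basis (R : realType) (m n : nat) (F : 'M[R]_(m, n))
    (A : {set 'I_m}) (B : {set 'I_n}) :
  exists s : {set 'I_m}, [/\ s \subset A, (#|s| <= \rank (mask F A B))%N &
    forall j j', j \in B -> j' \in B -> (forall i, i \in s -> F i j = F i j') ->
    forall i, i \in A -> F i j = F i j'].
Proof.
set M := mask F A B; pose h := maxrankfun M.
(* Rows of [M] outside [A] vanish, so intersecting with [A] loses nothing from the combinations. *)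
exists ([set h k | k : 'I_(\rank M)] :&: A); split; first exact: subsetIr.
  apply: leq_trans (subset_leq_card (subsetIl _ _)) _.
  by apply: leq_trans (leq_imset_card _ _) _; rewrite card_ord.
move=> j j' jB j'B hs i iA.
have /submxP[w wE] : (row i M <= rowsub h M)%MS by rewrite eq_maxrowsub row_sub.
have Me k : k \in B -> F i k = \sum_l w 0 l * M (h l) k.
  move=> kB; transitivity (row i M 0 k); first by rewrite !mxE iA kB mulr1.
  by rewrite wE !mxE; apply: eq_bigr => l _; rewrite !mxE.
rewrite !Me //; apply: eq_bigr => l _; congr (_ * _); rewrite !mxE jB j'B !andbT.
have [hA|] := boolP (h l \in A); last by rewrite !mulr0.
by rewrite hs // inE hA andbT; apply/imsetP; exists l.
Qed.

Lemma mask_col_basis (R : realType) (m n : nat) (F : 'M[R]_(m, n))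
    (A : {set 'I_m}) (B : {set 'I_n}) :
  exists s : {set 'I_n}, [/\ s \subset B, (#|s| <= \rank (mask F A B))%N &
    forall i i', i \in A -> i' \in A -> (forall j, j \in s -> F i j = F i' j) ->
    forall j, j \in B -> F i j = F i' j].
Proof.
have [s [sB cs hs]] := mask_row_basis F^T B A.
exists s; split=> //; first by rewrite -mxrank_tr -mask_tr.
move=> i i' iA i'A h j jB.
have := hs i i' iA i'A _ j jB; rewrite !mxE; apply=> // k ks.
by rewrite !mxE h.
Qed.

(** * Density increment *)

Section DensityIncrement.
Variables (R : realType) (m n : nat) (F : 'M[R]_(m, n)).
Hypothesis F_sign : forall i j, F i j = -1 \/ F i j = 1.

Local Notation cnt := (cnt F).

Lemma cntE c (A : {set 'I_m}) (B : {set 'I_n}) :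
  cnt c A B = (\sum_(i in A) #|[set j in B | F i j == c]|)%:R.
Proof.
rewrite /cnt /rsum natr_sum [RHS]big_mkcond; apply: eq_bigr => i _.
rewrite -sum1_card natr_sum; case: ifP => iA; first rewrite [RHS]big_mkcond.
  by apply: eq_bigr => j _; rewrite inE; case: (j \in B); case: (_ == _);
    rewrite ?mulr0 ?mulr1.
by rewrite big1 // => j _; rewrite mulr0.
Qed.

Lemma cntD (A : {set 'I_m}) (B : {set 'I_n}) :
  cnt 1 A B + cnt (-1) A B = (#|A| * #|B|)%:R.
Proof.
rewrite !cntE -natrD -big_split /= -sum_nat_const; congr (_%:R).
apply: eq_bigr => i _; rewrite -cardsUI (_ : _ :&: _ = finset.set0).
  rewrite cards0 addn0; apply: eq_card => j; rewrite !inE -andb_orr.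
  by case: (F_sign i j) => ->; rewrite eqxx ?orbT andbT.
apply/setP => j; rewrite !inE; case: (j \in B) => //=.
by case: (F_sign i j) => ->; rewrite ?(eq_sym 1 (-1)) N1_eq1F ?andbF.
Qed.

(** Steps are repeated under the invariant that [N ^+ K * P0 <= P ^+ K.+1], where [P] and [N] count
    ones and minus ones. While [P < 4 r N] it forces [P0 <= P * (4 r) ^ K], and the last step costs
    at most a further factor [K] in [P]. *)
Lemma density_increment (r K : nat) (P0 : R) (A : {set 'I_m}) (B : {set 'I_n}) :
  (\rank (mask F A B) <= r)%N -> 48 * Num.sqrt r%:R < K%:R :> R -> 0 < P0 ->
  0 < cnt 1 A B -> cnt (-1) A B ^+ K * P0 <= cnt 1 A B ^+ K.+1 ->
  cnt 1 A B < (4 * r)%:R * cnt (-1) A B ->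
  exists (A' : {set 'I_m}) (B' : {set 'I_n}), [/\ A' \subset A, B' \subset B,
    (4 * r)%:R * cnt (-1) A' B' <= cnt 1 A' B' &
    P0 <= (K * (4 * r) ^ K)%:R * cnt 1 A' B'].
Proof.
move=> + hK P00.
have [k hk] := ubnP (#|A| + #|B|)%N; elim: k A B hk => // k IH A B hk rr Pp inv PN.
set P := cnt 1 A B in Pp inv PN; set N := cnt (-1) A B in inv PN.
have r0 : 0 <= (4 * r)%:R :> R by [].
have Np : 0 < N.
  rewrite lt_neqAle cnt_ge0 andbT; apply/eqP => N0; move: PN.
  by rewrite -N0 mulr0 ltNge ltW.
have K0 : 0 < K%:R :> R by apply: le_lt_trans hK; rewrite mulr_ge0 ?sqrtr_ge0.
have [A' [B' [sA sB hAB]]] := rectangle_step F_sign rr hK Pp Np.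
rewrite -/P -/N in hAB.
set P' := cnt 1 A' B' in hAB *; set N' := cnt (-1) A' B' in hAB *.
set p := P' / P in hAB; set q := N' / N in hAB.
have q0 : 0 <= q by rewrite divr_ge0 ?cnt_ge0 // ltW.
have Ki : 0 < K%:R^-1 :> R by rewrite invr_gt0.
have pK : K%:R^-1 <= p by lra.
have p0 : 0 < p by lra.
have P'e : P' = p * P by rewrite /p divfK // lt0r_neq0.
have N'e : N' = q * N by rewrite /q divfK // lt0r_neq0.
have P'p : 0 < P' by rewrite P'e mulr_gt0.
have PP' : P <= K%:R * P'.
  by rewrite P'e mulrA ler_peMl ?(ltW Pp) // -ler_pdivrMl // mulr1.
have P0P : P0 <= P * (4 * r)%:R ^+ K.
  rewrite -(ler_pM2l (exprn_gt0 K Np)); apply: le_trans inv _.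
  rewrite exprS (mulrCA (N ^+ K)) -exprMn ler_pM2l //.
  by apply: lerXn2r; rewrite ?nnegrE ?mulr_ge0 ?cnt_ge0 // mulrC ltW.
have [hstop|hgo] := leP ((4 * r)%:R * N') P'.
  exists A', B'; split=> //; apply: le_trans P0P _.
  by rewrite (natrM _ K) natrX mulrAC ler_wpM2r ?exprn_ge0.
(* Termination: an unchanged rectangle would have [p = q = 1], against the gap [K^-1]. *)
have card_lt : (#|A'| + #|B'| < #|A| + #|B|)%N.
  rewrite ltnNge; apply/negP => hle.
  have eA : A' = A.
    apply/eqP; rewrite eqEcard sA -(leq_add2r #|B|).
    by apply: leq_trans hle _; rewrite leq_add2l subset_leq_card.
  have eB : B' = B.
    apply/eqP; rewrite eqEcard sB -(leq_add2l #|A|).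
    by apply: leq_trans hle _; rewrite leq_add2r subset_leq_card.
  move: hAB; rewrite /p /q /P' /N' eA eB !divff ?lt0r_neq0 // subrr.
  by rewrite leNgt Ki.
clearbody p q.
have inv' : N' ^+ K * P0 <= P' ^+ K.+1.
  rewrite N'e P'e !exprMn -mulrA.
  apply: (@le_trans _ _ (q ^+ K * P ^+ K.+1)); first by rewrite ler_wpM2l ?exprn_ge0.
  rewrite ler_wpM2r ?exprn_ge0 ?(ltW Pp) //.
  (* The gap says [q <= p * (1 - z)], and [K * z = p^-1], so [bernoulli_inv] yields
     [(1 - z) ^+ K <= p]. Hence [q ^+ K <= p ^+ K.+1], which is what preserves the invariant. *)
  pose z := K%:R^-1 / p.
  have z01 : 0 <= z <= 1 by rewrite divr_ge0 ?(ltW p0) ?(ltW Ki) //= ler_pdivrMr // mul1r.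
  have qz : q <= p * (1 - z) by rewrite mulrBr mulr1 /z mulrCA divff ?lt0r_neq0 // mulr1; lra.
  have := bernoulli_inv K z01.
  rewrite /z mulrA divff ?lt0r_neq0 // mul1r -/z => hz.
  have hz' : (1 - z) ^+ K <= p.
    have h1z : 0 <= (1 - z) ^+ K by rewrite exprn_ge0 // subr_ge0; case/andP: z01.
    rewrite -[X in _ <= X]mul1r -ler_pdivrMr //; apply: le_trans hz; rewrite ler_wpM2l //; lra.
  apply: (@le_trans _ _ (p ^+ K * (1 - z) ^+ K)).
    by rewrite -exprMn lerXn2r // nnegrE // (le_trans q0).
  by rewrite exprSr ler_wpM2l // exprn_ge0 // ltW.
have [A1 [B1 [sA1 sB1 h1 h2]]] := IH A' B' (leq_trans card_lt hk)
  (leq_trans (sub_mask_rank _ sA sB) rr) P'p inv' hgo.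
exists A1, B1; split=> //; [exact: fintype.subset_trans sA1 sA|exact: fintype.subset_trans sB1 sB].
Qed.
End DensityIncrement.

(** Different rows may carry different constants; such a rectangle still has rank at most one, which
    is all that peeling uses. *)
Definition rows_constant (R : realType) (m n : nat) (F : 'M[R]_(m, n))
    (A : {set 'I_m}) (B : {set 'I_n}) :=
  forall i j j', i \in A -> j \in B -> j' \in B -> F i j = F i j'.

Lemma rank_rows_constant (R : realType) (m n : nat) (F : 'M[R]_(m, n))
    (A : {set 'I_m}) (B : {set 'I_n}) :
  rows_constant F A B -> (\rank (mask F A B) <= 1)%N.
Proof.
move=> h; have [->|[j0 j0B]] := set_0Vmem B.
  rewrite (_ : mask _ _ _ = 0) ?mxrank0 //.
  by apply/matrixP => i j; rewrite !mxE inE andbF mulr0.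
rewrite (_ : mask F A B = (\col_i (F i j0 * (i \in A)%:R)) *m (\row_j (j \in B)%:R)).
  by apply: leq_trans (mxrankM_maxr _ _) (rank_leq_row _).
apply/matrixP => i j; rewrite !mxE big_ord1 !mxE.
have [iA|] := boolP (i \in A); have [jB|] := boolP (j \in B); rewrite ?mulr0 ?mul0r ?mulr1 //.
exact: h.
Qed.

(** * From nearly constant rectangles to rank one *)

Section NearlyConstant.
Variables (R : realType) (m n : nat) (F : 'M[R]_(m, n)).
Hypothesis F_sign : forall i j, F i j = -1 \/ F i j = 1.

(** By Markov's inequality at least half of the rows have minus ones in at most a fraction
    [1 / (2 r)] of [B]. Deleting the columns where one of at most [r] basis rows is -1 costs at most
    half of [B]; the remaining columns agree on the basis, hence on all kept rows. *)
Lemma rows_constant_subrectangle (r : nat) (A : {set 'I_m}) (B : {set 'I_n}) :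
  (0 < r)%N -> (\rank (mask F A B) <= r)%N ->
  (4 * r)%:R * cnt F (-1) A B <= cnt F 1 A B ->
  exists (A' : {set 'I_m}) (B' : {set 'I_n}), [/\ A' \subset A, B' \subset B,
    rows_constant F A' B' & (#|A| * #|B| <= 4 * (#|A'| * #|B'|))%N].
Proof.
move=> r0 rr hc.
pose neg i := [set j in B | F i j == -1].
have hN : (4 * r * (\sum_(i in A) #|neg i|) <= #|A| * #|B|)%N.
  rewrite -(ler_nat R) natrM -(cntE F (-1) A B) -(cntD F_sign).
  by apply: le_trans hc _; rewrite lerDl cnt_ge0.
pose A' := [set i in A | (2 * r * #|neg i| <= #|B|)%N].
have sA' : A' \subset A by apply/fintype.subsetP => i; rewrite inE => /andP[].
have hbad : (#|A :\: A'| * #|B| <= 2 * r * \sum_(i in A) #|neg i|)%N.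
  rewrite -sum_nat_const big_distrr /= [X in (_ <= X)%N](big_setID A') /=.
  apply: leq_trans (leq_addl _ _); apply: leq_sum => i.
  rewrite !inE negb_and -ltnNge => /andP[/orP[/negP h /h //|h _]].
  exact: ltnW h.
have [s [ss cs hs]] := mask_row_basis F A' B.
pose B' := [set j in B | [forall i in s, F i j == 1]].
have sB' : B' \subset B by apply/fintype.subsetP => i; rewrite inE => /andP[].
have rA' : (#|s| <= r)%N.
  by apply: leq_trans cs (leq_trans (sub_mask_rank _ sA' (fintype.subxx _)) rr).
have hB' : (2 * r * #|B :\: B'| <= r * #|B|)%N.
  have h1 : (#|B :\: B'| <= \sum_(i in s) #|neg i|)%N.
    apply: (@leq_trans #|\bigcup_(i in s) neg i|).
      apply: subset_leq_card; apply/fintype.subsetP => j.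
      rewrite !inE negb_and andb_orl andNb /= => /andP[/forall_inPn[i si hi] jB].
      apply/finset.bigcupP; exists i => //; rewrite inE jB /=.
      by case: (F_sign i j) hi => ->; rewrite ?eqxx.
    elim/big_rec2: _ => [|i k C _ hC]; first by rewrite cards0.
    by rewrite cardsU (leq_trans (leq_subr _ _)) // leq_add2l.
  apply: leq_trans (leq_mul (leqnn _) h1) _; rewrite big_distrr /=.
  apply: (@leq_trans (\sum_(i in s) #|B|)).
    by apply: leq_sum => i /(fintype.subsetP ss); rewrite inE => /andP[].
  by rewrite sum_nat_const leq_mul2r rA' orbT.
have [cB|cB] := posnP #|B|.
  by exists A, B; split=> //; [move=> i j j' _; rewrite (cards0_eq cB) inE | lia].
exists A', B'; split=> //.
  move=> i j j' iA'; rewrite !inE => /andP[jB /forall_inP hj] /andP[j'B /forall_inP hj'].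
  by apply: hs => // k ks; rewrite (eqP (hj _ ks)) (eqP (hj' _ ks)).
have eA := cardsID A' A; have eB := cardsID B' B.
move: eA eB; rewrite (finset.setIidPr sA') (finset.setIidPr sB') => eA eB.
have h1 : (2 * #|A :\: A'| <= #|A|)%N.
  rewrite -(leq_pmul2r cB); nia.
have h2 : (2 * #|B :\: B'| <= #|B|)%N by rewrite -(leq_pmul2l r0); lia.
have -> : (4 * (#|A'| * #|B'|) = (2 * #|A'|) * (2 * #|B'|))%N by lia.
by apply: leq_mul; lia.
Qed.

(** The factor 8 is 2, as ones fill at least half of the rectangle, times the 4 lost in passing to
    constant rows. *)
Lemma big_rectangle_majority (r K : nat) (A : {set 'I_m}) (B : {set 'I_n}) :
  (0 < r)%N -> (\rank (mask F A B) <= r)%N -> 48 * Num.sqrt r%:R < K%:R :> R ->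
  cnt F (-1) A B <= cnt F 1 A B ->
  exists (A' : {set 'I_m}) (B' : {set 'I_n}), [/\ A' \subset A, B' \subset B,
    rows_constant F A' B' &
    (#|A| * #|B| <= 8 * K * (4 * r) ^ K * (#|A'| * #|B'|))%N].
Proof.
move=> r0 rr hK hmaj.
have K0 : (0 < K)%N.
  by rewrite -(ltr0n R); apply: le_lt_trans hK; rewrite mulr_ge0 ?sqrtr_ge0.
have KK : (0 < K * (4 * r) ^ K)%N by rewrite muln_gt0 K0 expn_gt0 muln_gt0 r0.
have AB := cntD F_sign A B.
have [A1 [B1 [sA sB hd h0]]] : exists (A' : {set 'I_m}) (B' : {set 'I_n}),
    [/\ A' \subset A, B' \subset B,
      (4 * r)%:R * cnt F (-1) A' B' <= cnt F 1 A' B' &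
      cnt F 1 A B <= (K * (4 * r) ^ K)%:R * cnt F 1 A' B'].
  have [hstop|hgo] := leP ((4 * r)%:R * cnt F (-1) A B) (cnt F 1 A B).
    by exists A, B; split=> //; rewrite ler_peMl ?cnt_ge0 // ler1n.
  have [P0|P0] := ltP 0 (cnt F 1 A B); last first.
    move: hgo; rewrite ltNge; case/negP; apply: le_trans (cnt_ge0 F 1 A B).
    by rewrite mulr_ge0_le0 // (le_trans hmaj).
  (* With [P0] the initial number of ones, the invariant at the start is the majority hypothesis
     raised to the power [K]. *)
  apply: density_increment => //.
  by rewrite exprSr ler_wpM2r ?cnt_ge0 // lerXn2r ?nnegrE ?cnt_ge0.
have [A2 [B2 [sA2 sB2 hc h2]]] := rows_constant_subrectangle r0
  (leq_trans (sub_mask_rank _ sA sB) rr) hd.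
exists A2, B2; split=> //.
- exact: fintype.subset_trans sA2 sA.
- exact: fintype.subset_trans sB2 sB.
rewrite -(ler_nat R) -AB.
have h3 : cnt F 1 A1 B1 <= (4 * (#|A2| * #|B2|))%:R.
  by apply: le_trans (_ : (#|A1| * #|B1|)%:R <= _); rewrite ?ler_nat // -(cntD F_sign) lerDl cnt_ge0.
apply: (@le_trans _ _ (2 * cnt F 1 A B)); first lra.
apply: (@le_trans _ _ (2 * ((K * (4 * r) ^ K)%:R * (4 * (#|A2| * #|B2|))%:R))).
  by rewrite ler_wpM2l // (le_trans h0) // ler_wpM2l.
rewrite -!natrM ler_nat; apply: eq_leq.
by move: ((4 * r) ^ K)%N => E; ring.
Qed.
End NearlyConstant.

Lemma big_rectangle (R : realType) (m n : nat) (F : 'M[R]_(m, n))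
    (r K : nat) (A : {set 'I_m}) (B : {set 'I_n}) :
  (forall i j, F i j = -1 \/ F i j = 1) ->
  (0 < r)%N -> (\rank (mask F A B) <= r)%N -> 48 * Num.sqrt r%:R < K%:R :> R ->
  exists (A' : {set 'I_m}) (B' : {set 'I_n}), [/\ A' \subset A, B' \subset B,
    rows_constant F A' B' &
    (#|A| * #|B| <= 8 * K * (4 * r) ^ K * (#|A'| * #|B'|))%N].
Proof.
move=> F_sign r0 rr hK.
have [h|h] := leP (cnt F (-1) A B) (cnt F 1 A B); first exact: big_rectangle_majority.
have oF : forall i j, (- F) i j = -1 \/ (- F) i j = 1.
  by move=> i j; rewrite mxE; case: (F_sign i j) => ->; rewrite ?opprK; [right|left].
have co c : cnt (- F) c A B = cnt F (- c) A B.
  apply: eq_bigr => i _; apply: eq_bigr => j _.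
  by rewrite mxE eqr_oppLR.
have ro : (\rank (mask (- F) A B) <= r)%N.
  rewrite (_ : mask _ _ _ = - mask F A B) ?mxrank_opp //.
  by apply/matrixP => i j; rewrite !mxE mulNr.
have [|A' [B' [sA sB hc hs]]] := big_rectangle_majority oF r0 ro hK.
  by rewrite !co opprK ltW.
exists A', B'; split=> // i j j' iA jB j'B.
by have := hc _ _ _ iA jB j'B; rewrite !mxE => /oppr_inj.
Qed.

(* Each large rectangle of rank one is peeled off along whichever of its two
   sides has rank at most [(r + 1) / 2]; that side gets a fresh label. *)
Lemma rank_halving_labels (R : realType) (m n : nat) (F : 'M[R]_(m, n)) (r K N : nat)
    (A : {set 'I_m}) (B : {set 'I_n}) :
  (forall i j, F i j = -1 \/ F i j = 1) ->
  (0 < r)%N -> (\rank (mask F A B) <= r)%N -> 48 * Num.sqrt r%:R < K%:R :> R ->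
  (#|A| * #|B|)%:R * (1 - (8 * K * (4 * r) ^ K)%:R^-1) ^+ N < 1 :> R ->
  exists (al : 'I_m -> nat) (be : 'I_n -> nat),
  [/\ forall i, (al i <= N)%N, forall j, (be j <= N)%N &
    forall a b, (\rank (mask F [set i in A | al i == a] [set j in B | be j == b])
                  <= r.+1./2)%N].
Proof.
move=> F_sign r0 + hK; set Z := (8 * K * _)%N.
elim: N A B => [|N IH] A B rr hsz.
  exists (fun=> 0%N), (fun=> 0%N); split=> // a b.
  rewrite (_ : mask _ _ _ = 0) ?mxrank0 //; apply/matrixP => i j; rewrite !mxE !inE.
  move: hsz; rewrite expr0 mulr1 -[1]/(1%:R) ltr_nat ltnS leqn0 muln_eq0 !cards_eq0.
  by case/orP => /eqP ->; rewrite !inE ?andbF mulr0.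
have [A' [B' [sA sB hc hs]]] := big_rectangle F_sign r0 rr hK; rewrite -/Z in hs.
have Frob := mask_Frobenius F sA sB; have r1 := rank_rows_constant hc.
have K0 : (0 < K)%N.
  by rewrite -(ltr0n R); apply: le_lt_trans hK; rewrite mulr_ge0 ?sqrtr_ge0.
have Z0 : (0 < Z)%N by rewrite !muln_gt0 K0 expn_gt0 muln_gt0 r0.
have Zp : 0 < Z%:R :> R by rewrite ltr0n.
have e0 : 0 <= 1 - Z%:R^-1 :> R by rewrite subr_ge0 invf_le1 // ler1n.
(* Removing all of [A'] or all of [B'] discards at least the area of the peeled rectangle, a
   fraction [1 / Z] of the total. *)
have size_step (u : nat) : (u * Z + #|A| * #|B| <= #|A| * #|B| * Z)%N ->
    u%:R * (1 - Z%:R^-1) ^+ N < 1 :> R.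
  move=> hu; apply: le_lt_trans hsz; rewrite exprS mulrA ler_wpM2r ?exprn_ge0 //.
  rewrite mulrBr mulr1 -(ler_pM2r Zp) mulrBl -mulrA mulVf ?lt0r_neq0 // mulr1.
  by rewrite lerBrDr -!natrM -natrD ler_nat.
have eA := cardsID A' A; have eB := cardsID B' B.
move: eA eB; rewrite (finset.setIidPr sA) (finset.setIidPr sB) => eA eB.
have cA := subset_leq_card sA; have cB := subset_leq_card sB.
have [hr|hr] := leqP (\rank (mask F A' B)) r.+1./2.
- have [||al [be [hal hbe hrk]]] := IH (A :\: A') B.
  + exact: leq_trans (sub_mask_rank _ (subsetDl _ _) (fintype.subxx _)) rr.
  + apply: size_step; rewrite -[in X in (_ <= X)%N]eA !mulnDl addnC leq_add2r.
    by apply: leq_trans hs _; rewrite mulnC leq_mul2r leq_mul2l cB !orbT.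
  (* Recursive labels are at most [N], so [N.+1] is fresh; its class is contained in [A'], whose
     rank against all of [B] is small. *)
  exists (fun i => if i \in A' then N.+1 else al i), be; split=> [i|j|a b].
  + by case: ifP => // _; exact: leqW.
  + exact: leqW.
  have [->|aN] := eqVneq a N.+1.
    apply: leq_trans hr; apply: sub_mask_rank; apply/fintype.subsetP => i.
      rewrite inE => /andP[_]; case: ifP => // _ /eqP aE; move: (hal i).
      by rewrite aE ltnn.
    by rewrite inE => /andP[].
  apply: leq_trans (hrk a b); apply: sub_mask_rank => //.
  apply/fintype.subsetP => i; rewrite !inE => /andP[->].
  by case: ifP => [_|_ ->] //; rewrite eq_sym (negPf aN).
- have hr' : (\rank (mask F A B') <= r.+1./2)%N.
    by clear -hr Frob r1 rr; lia.
  have [||al [be [hal hbe hrk]]] := IH A (B :\: B').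
  + exact: leq_trans (sub_mask_rank _ (fintype.subxx _) (subsetDl _ _)) rr.
  + apply: size_step; rewrite -[in X in (_ <= X)%N]eB mulnDr !mulnDl addnC leq_add2r.
    by apply: leq_trans hs _; rewrite mulnC leq_mul2r leq_mul2r cA !orbT.
  exists al, (fun j => if j \in B' then N.+1 else be j); split=> [i|j|a b].
  + exact: leqW.
  + by case: ifP => // _; exact: leqW.
  have [->|bN] := eqVneq b N.+1.
    apply: leq_trans hr'; apply: sub_mask_rank; apply/fintype.subsetP => j.
      by rewrite inE => /andP[].
    rewrite inE => /andP[_]; case: ifP => // _ /eqP bE; move: (hbe j).
    by rewrite bE ltnn.
  apply: leq_trans (hrk a b); apply: sub_mask_rank => //.
  apply/fintype.subsetP => j; rewrite !inE => /andP[->].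
  by case: ifP => [_|_ ->] //; rewrite eq_sym (negPf bN).
Qed.

(** * Protocols *)

Fixpoint precomp (X X' Y Y' Z : Type) (phi : X' -> X) (psi : Y' -> Y)
    (p : protocol X Y Z) : protocol X' Y' Z :=
  match p with
  | Leaf oX oY => Leaf (oX \o phi) (oY \o psi)
  | SendX b p1 p0 => SendX (b \o phi) (precomp phi psi p1) (precomp phi psi p0)
  | SendY b p1 p0 => SendY (b \o psi) (precomp phi psi p1) (precomp phi psi p0)
  end.

Lemma precompE (X X' Y Y' Z : Type) (phi : X' -> X) (psi : Y' -> Y)
    (p : protocol X Y Z) x y :
  outputs (precomp phi psi p) x y = outputs p (phi x) (psi y) /\
  bits (precomp phi psi p) x y = bits p (phi x) (psi y).
Proof.
elim: p => //= b p1 [IH1 IH1'] p0 [IH0 IH0']; case: (b _); by rewrite ?IH1' ?IH0'.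
Qed.

Section Solvable.
Variables (R : realType) (m n : nat) (F : 'M[R]_(m, n)).

(** Nothing is asked outside [A] and [B], so protocols for separate blocks can be glued. *)
Definition solvable (A : {set 'I_m}) (B : {set 'I_n}) (d : nat) :=
  exists p : protocol 'I_m 'I_n R, forall i j, i \in A -> j \in B ->
    outputs p i j = (F i j, F i j) /\ (bits p i j <= d)%N.

Lemma solvable_sub (A A' : {set 'I_m}) (B B' : {set 'I_n}) d : A' \subset A -> B' \subset B ->
  solvable A B d -> solvable A' B' d.
Proof.
move=> /fintype.subsetP sA /fintype.subsetP sB [p hp].
by exists p => i j iA jB; apply: hp; [exact: sA|exact: sB].
Qed.

Lemma solvable_sendX (b : 'I_m -> bool) (A : {set 'I_m}) B d :
  solvable [set i in A | b i] B d -> solvable [set i in A | ~~ b i] B d ->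
  solvable A B d.+1.
Proof.
move=> [p1 h1] [p0 h0]; exists (SendX b p1 p0) => i j iA jB /=.
by case: ifP => bi; [apply: h1|apply: h0]; rewrite ?inE ?iA ?bi.
Qed.

Lemma solvable_sendY (b : 'I_n -> bool) A (B : {set 'I_n}) d :
  solvable A [set j in B | b j] d -> solvable A [set j in B | ~~ b j] d ->
  solvable A B d.+1.
Proof.
move=> [p1 h1] [p0 h0]; exists (SendY b p1 p0) => i j iA jB /=.
by case: ifP => bj; [apply: h1|apply: h0]; rewrite ?inE ?jB ?bj.
Qed.

(** The row player announces the label by binary search: each bit halves the window of length
    [2 ^ l] that starts at [o]. *)
Lemma solvable_labelX (l d o : nat) (al : 'I_m -> nat) (A : {set 'I_m}) B :
  (forall i, i \in A -> (o <= al i < o + 2 ^ l)%N) ->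
  (forall a, solvable [set i in A | al i == a] B d) -> solvable A B (l + d).
Proof.
elim: l o A => [|l IH] o A hal hs.
  apply: solvable_sub (hs o) => //; apply/fintype.subsetP => i iA.
  by rewrite inE iA /=; move: (hal i iA); rewrite addn1 ltnS -eqn_leq eq_sym.
have sub (C : {set 'I_m}) : C \subset A ->
    forall a, solvable [set i in C | al i == a] B d.
  move=> /fintype.subsetP sC a; apply: solvable_sub (hs a) => //.
  by apply/fintype.subsetP => i; rewrite !inE => /andP[/sC -> ->].
have sI (b : 'I_m -> bool) : [set i in A | b i] \subset A.
  by apply/fintype.subsetP => i; rewrite inE => /andP[].
rewrite addSn; apply: (@solvable_sendX (fun i => al i < o + 2 ^ l)%N).
  by apply: (IH o) (sub _ (sI _)) => i; rewrite inE => /andP[/hal/andP[-> _]].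
apply: (IH (o + 2 ^ l)%N) (sub _ (sI _)) => i.
rewrite inE -leqNgt => /andP[/hal/andP[_ h2] ->].
by rewrite -addnA addnn -mul2n -expnS.
Qed.

Lemma solvable_labelY (l d o : nat) (be : 'I_n -> nat) A (B : {set 'I_n}) :
  (forall j, j \in B -> (o <= be j < o + 2 ^ l)%N) ->
  (forall b, solvable A [set j in B | be j == b] d) -> solvable A B (l + d).
Proof.
elim: l o B => [|l IH] o B hbe hs.
  apply: solvable_sub (hs o) => //; apply/fintype.subsetP => j jB.
  by rewrite inE jB /=; move: (hbe j jB); rewrite addn1 ltnS -eqn_leq eq_sym.
have sub (C : {set 'I_n}) : C \subset B ->
    forall b, solvable A [set j in C | be j == b] d.
  move=> /fintype.subsetP sC b; apply: solvable_sub (hs b) => //.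
  by apply/fintype.subsetP => j; rewrite !inE => /andP[/sC -> ->].
have sI (b : 'I_n -> bool) : [set j in B | b j] \subset B.
  by apply/fintype.subsetP => j; rewrite inE => /andP[].
rewrite addSn; apply: (@solvable_sendY (fun j => be j < o + 2 ^ l)%N).
  by apply: (IH o) (sub _ (sI _)) => j; rewrite inE => /andP[/hbe/andP[-> _]].
apply: (IH (o + 2 ^ l)%N) (sub _ (sI _)) => j.
rewrite inE -leqNgt => /andP[/hbe/andP[_ h2] ->].
by rewrite -addnA addnn -mul2n -expnS.
Qed.

Lemma solvable_precomp (phi : 'I_m -> 'I_m) (psi : 'I_n -> 'I_n)
    (A A0 : {set 'I_m}) (B B0 : {set 'I_n}) d :
  (forall i, i \in A -> phi i \in A0) -> (forall j, j \in B -> psi j \in B0) ->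
  (forall i j, i \in A -> j \in B -> F (phi i) (psi j) = F i j) ->
  solvable A0 B0 d -> solvable A B d.
Proof.
move=> hphi hpsi hF [p hp]; exists (precomp phi psi p) => i j iA jB.
have [-> ->] := precompE phi psi p i j; rewrite -hF //.
by apply: hp; [exact: hphi|exact: hpsi].
Qed.

Hypothesis F_sign : forall i j, F i j = -1 \/ F i j = 1.

(** The row player sends the entries of the row at the columns in [l], which determine the row on
    [B]; the column player then sends the answer, the one extra bit. *)
Lemma solvable_col_basis (l : seq 'I_n) (A : {set 'I_m}) (B : {set 'I_n}) :
  (forall i i', i \in A -> i' \in A -> (forall j, j \in l -> F i j = F i' j) ->
    forall j, j \in B -> F i j = F i' j) ->
  solvable A B (size l).+1.
Proof.
elim: l A => [|j0 l IH] A hl.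
  have [->|[i0 i0A]] := set_0Vmem A.
    by exists (Leaf (fun=> 0) (fun=> 0)) => i j; rewrite inE.
  exists (SendY (fun j => F i0 j == 1) (Leaf (fun=> 1) (fun=> 1))
                (Leaf (fun=> -1) (fun=> -1))) => i j iA jB /=.
  rewrite (hl i i0) //.
  by case: (F_sign i0 j) => ->; rewrite ?eqxx ?N1_eq1F.
have agree i i' : (F i j0 == 1) = (F i' j0 == 1) -> F i j0 = F i' j0.
  by case: (F_sign i j0) => ->; case: (F_sign i' j0) => ->; rewrite ?eqxx ?N1_eq1F.
apply: (@solvable_sendX (fun i => F i j0 == 1)); apply: IH => i i';
  rewrite !inE => /andP[iA hi] /andP[i'A hi'] hj; apply: hl => // j;
  rewrite inE => /orP[/eqP ->|/hj //]; apply: agree.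
  by rewrite hi hi'.
by rewrite (negPf hi) (negPf hi').
Qed.

Lemma solvable_rank A B : solvable A B (\rank (mask F A B)).+1.
Proof.
have [s [sB cs hs]] := mask_col_basis F A B.
have h : solvable A B (size (enum s)).+1.
  apply: solvable_col_basis => i i' iA i'A hj; apply: hs => // j js.
  by apply: hj; rewrite mem_enum.
move: h => [p hp]; exists p => i j iA jB; have [-> hb] := hp i j iA jB; split=> //.
by apply: leq_trans hb _; rewrite ltnS -cardE.
Qed.

End Solvable.

(** A row is determined by its signs on a column basis. Merging equal rows bounds the size of the
    matrix in terms of its rank alone, which bounds the number of peeling rounds. *)
Lemma row_representatives (R : realType) (m n : nat) (F : 'M[R]_(m, n))
    (A : {set 'I_m}) (B : {set 'I_n}) :
  (forall i j, F i j = -1 \/ F i j = 1) ->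
  exists (phi : 'I_m -> 'I_m) (A0 : {set 'I_m}),
  [/\ A0 \subset A, (#|A0| <= 2 ^ \rank (mask F A B))%N,
      forall i, i \in A -> phi i \in A0 &
      forall i j, i \in A -> j \in B -> F (phi i) j = F i j].
Proof.
move=> F_sign; have [s [sB cs hs]] := mask_col_basis F A B.
pose key i := [set j in s | F i j == 1].
(* On [A] the default is never reached, since [i] itself qualifies; so [phi i] depends only on
   [key i]. *)
pose phi i := odflt i [pick x | (x \in A) && (key x == key i)].
have phiP i : i \in A -> (phi i \in A) /\ key (phi i) = key i.
  rewrite /phi => iA; case: pickP => [x /andP[xA /eqP xk] //|/(_ i)].
  by rewrite iA eqxx.
have phi_eq i i' : i \in A -> i' \in A -> key i = key i' -> phi i = phi i'.
  move=> iA i'A kk; rewrite /phi kk; case: pickP => // /(_ i').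
  by rewrite i'A eqxx.
exists phi, (phi @: A); split.
- by apply/fintype.subsetP => _ /imsetP[i iA ->]; case: (phiP i iA).
- have kinj : {in phi @: A &, injective key}.
    move=> _ _ /imsetP[i iA ->] /imsetP[i' i'A ->].
    by rewrite (phiP i iA).2 (phiP i' i'A).2; exact: phi_eq.
  rewrite -(card_in_imset kinj); apply: leq_trans (_ : #|powerset s| <= _)%N.
    apply: subset_leq_card; apply/fintype.subsetP => _ /imsetP[i _ ->].
    by rewrite inE; apply/fintype.subsetP => j; rewrite inE => /andP[].
  by rewrite card_powerset leq_exp2l.
- by move=> i iA; apply: imset_f.
- move=> i j iA jB; have [pA pk] := phiP i iA.
  apply: hs => // k ks; move/setP: pk => /(_ k); rewrite !inE ks /=.
  by case: (F_sign i k) => ->; case: (F_sign (phi i) k) => ->; rewrite ?eqxx ?N1_eq1F.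
Qed.

Lemma solvable_halving (R : realType) (m n : nat) (F : 'M[R]_(m, n)) (r K l d : nat) :
  (forall i j, F i j = -1 \/ F i j = 1) -> (0 < r)%N ->
  48 * Num.sqrt r%:R < K%:R :> R ->
  (8 * K * (4 * r) ^ K * (2 * r).+1 < 2 ^ l)%N ->
  (forall A B, (\rank (mask F A B) <= r.+1./2)%N -> solvable F A B d) ->
  forall A B, (\rank (mask F A B) <= r)%N -> solvable F A B (l + (l + d)).
Proof.
move=> F_sign r0 hK hl hd A B rr.
have FT_sign i j : F^T i j = -1 \/ F^T i j = 1 by rewrite mxE.
have [phi [A0 [sA cA hphi ephi]]] := row_representatives A B F_sign.
have [psi [B0 [sB cB hpsi epsi]]] := row_representatives B A FT_sign.
apply: (solvable_precomp hphi hpsi) => [i j iA jB|].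
  have := epsi j (phi i) jB (fintype.subsetP sA _ (hphi i iA)).
  by rewrite !mxE => ->; exact: ephi.
rewrite mask_tr mxrank_tr in cB.
set Z := (8 * K * _)%N in hl.
have K0 : (0 < K)%N.
  by rewrite -(ltr0n R); apply: le_lt_trans hK; rewrite mulr_ge0 ?sqrtr_ge0.
have Z0 : (0 < Z)%N by rewrite !muln_gt0 K0 expn_gt0 muln_gt0 r0.
have Zp : 0 < Z%:R :> R by rewrite ltr0n.
have z01 : 0 <= (Z%:R^-1 : R) <= 1 by rewrite invr_ge0 ler0n invf_le1 // ler1n.
(* Every [Z] rounds at least halve the area, which is at most [2 ^ (2 * r)] after merging;
   [2 * r + 1] halvings bring it below 1. *)
have [] := @rank_halving_labels _ _ _ F r K (Z * (2 * r).+1) A0 B0 F_sign r0 _ hK.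
- exact: leq_trans (sub_mask_rank _ sA sB) rr.
- rewrite -/Z exprM; have := bernoulli_inv Z z01; rewrite divff ?lt0r_neq0 //.
  set e := _ ^+ Z => he.
  have e0 : 0 <= e by rewrite exprn_ge0 // subr_ge0; case/andP: z01.
  have e2 : e <= 2^-1 by lra.
  apply: (@le_lt_trans _ _ ((2 ^ (2 * r))%:R * 2^-1 ^+ (2 * r).+1)).
    apply: ler_pM => //; first exact: exprn_ge0.
      rewrite ler_nat mul2n -addnn expnD leq_mul //.
        by apply: leq_trans cA _; rewrite leq_exp2l.
      by apply: leq_trans cB _; rewrite leq_exp2l.
    by apply: lerXn2r; rewrite ?nnegrE.
  rewrite natrX exprSr mulrA -exprMn divff // expr1n mul1r.
  by rewrite invf_lt1 // ltr1n.
move=> al [be [hal hbe hrk]].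
apply: (@solvable_labelX _ _ _ _ l _ 0%N al) => [i _|a].
  by rewrite add0n /= (leq_ltn_trans (hal i)).
apply: (@solvable_labelY _ _ _ _ l _ 0%N be) => [j _|b].
  by rewrite add0n /= (leq_ltn_trans (hbe j)).
exact/hd/hrk.
Qed.

(** * Choice of parameters and recursion on the rank *)

Lemma ln2_ge_half (R : realType) : 1 / 2 <= ln 2 :> R.
Proof.
have := @le_ln1Dx R (- (1 / 2)); rewrite (_ : 1 + - (1 / 2) = 2^-1); last by lra.
by rewrite lnV ?posrE //; lra.
Qed.

Lemma halving_label_bits (R : realType) (r : nat) : (8 <= r)%N ->
  exists K l : nat, [/\ 48 * Num.sqrt r%:R < K%:R :> R,
    (8 * K * (4 * r) ^ K * (2 * r).+1 < 2 ^ l)%N &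
    l%:R <= 735 * (Num.sqrt r%:R * ln r%:R) :> R].
Proof.
move=> r8; pose K := (Num.truncn (48 * Num.sqrt r%:R : R)).+1.
pose h := up_log 2 r.
have s1 : 1 <= Num.sqrt r%:R :> R by rewrite -[X in X <= _]sqrtr1 ler_wsqrtr // ler1n; lia.
have hK : 48 * Num.sqrt r%:R < K%:R :> R by exact: truncnS_gt.
have K49 : K%:R <= 49 * Num.sqrt r%:R :> R.
  rewrite /K -natr1.
  have s0 : 0 <= 48 * Num.sqrt r%:R :> R by rewrite mulr_ge0 ?sqrtr_ge0.
  by have := truncn_itv s0 => /andP[]; lra.
have rh : (r <= 2 ^ h)%N by exact: up_logP.
have hr : (2 ^ h.-1 < r)%N by apply: up_log_gtn => //; lia.
have h3 : (3 <= h)%N.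
  rewrite leqNgt; apply/negP; rewrite ltnS => h2.
  by have := leq_trans (leq_trans r8 rh) (leq_pexp2l (isT : (0 < 2)%N) h2).
have K1 : (1 <= K)%N by [].
(* The product is bounded by a power of two with exponent [3 + K + (2 + h) * K + (2 + h)], at most
   [5 * K * h] since [h >= 3]. The constant is [735 = 5 * 49 * 3], from [K <= 49 sqrt r] and
   [h <= 3 ln r]. *)
exists K, (5 * (K * h))%N; split=> //.
- have e1 : (8 * K * (4 * r) ^ K <= 2 ^ (3 + K + (2 + h) * K))%N.
    rewrite !expnD expnM leq_mul // ?leq_mul // ?(ltnW (ltn_expl _ _)) //.
    by rewrite leq_exp2r // expnD leq_mul.
  have e2 : ((2 * r).+1 < 2 ^ (2 + h))%N.
    apply: leq_trans (_ : 4 * r <= _)%N; first by clear -r8; lia.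
    by rewrite expnD leq_mul.
  apply: leq_trans (_ : 2 ^ (3 + K + (2 + h) * K + (2 + h)) <= _)%N.
    rewrite expnD; apply: leq_ltn_trans (_ : 2 ^ (3 + K + (2 + h) * K) * (2 * r).+1 < _)%N.
      by rewrite leq_mul.
    by rewrite ltn_pmul2l // expn_gt0.
  rewrite leq_exp2l //; clear -K1 h3; nia.
- have hln : h%:R <= 3 * ln r%:R :> R.
    have ln2 := ln2_ge_half R.
    have hl : h.-1%:R * ln 2 <= ln r%:R :> R.
      rewrite mulr_natl -lnXn // -natrX ler_ln ?posrE ?ltr0n ?expn_gt0 //; last by lia.
      by rewrite ler_nat ltnW.
    have e : h%:R = h.-1%:R + 1 :> R by rewrite natr1 prednK //; lia.
    have h2 : 2 <= h.-1%:R :> R by rewrite ler_nat; lia.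
    rewrite e; nra.
  have ln0 : 0 <= ln r%:R :> R by rewrite ln_ge0 // ler1n; lia.
  rewrite !natrM.
  apply: (@le_trans _ _ (5 * (49 * Num.sqrt r%:R * (3 * ln r%:R)))); last by lra.
  by rewrite ler_wpM2l // ler_pM.
Qed.

(** One halving costs [2 * 735] and, for [r >= 8], shrinks [sqrt r] by a factor of at most 3/4, so
    the constant [C = 5880] solves [C = 3 / 4 * C + 2 * 735]. Ranks below 8 use the protocol that
    sends the entries on a column basis. *)
Lemma solvable_of_rank (R : realType) (r : nat) : (0 < r)%N ->
  exists2 d : nat, d%:R <= 5880 * (Num.sqrt r%:R * ln (maxn r 2)%:R) :> R &
    forall (m n : nat) (F : 'M[R]_(m, n)) (A : {set 'I_m}) (B : {set 'I_n}),
      (forall i j, F i j = -1 \/ F i j = 1) ->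
      (\rank (mask F A B) <= r)%N -> solvable F A B d.
Proof.
have [k hk] := ubnP r; elim: k r hk => // k IH r hk r0.
have [r8|r8] := ltnP r 8.
  exists 8%N.
    have s1 : 1 <= Num.sqrt r%:R :> R by rewrite -[X in X <= _]sqrtr1 ler_wsqrtr // ler1n.
    have ln2 : 1 / 2 <= ln (maxn r 2)%:R :> R.
      apply: le_trans (ln2_ge_half R) _.
      by rewrite ler_ln ?posrE ?ltr0n ?ler_nat ?leq_max ?orbT.
    by move: s1 ln2; set x := Num.sqrt _; set y := ln _; nra.
  move=> m n F A B F_sign rr; have [p hp] := solvable_rank F_sign A B.
  exists p => i j iA jB; have [-> hb] := hp i j iA jB; split=> //.
  by apply: leq_trans hb _; apply: leq_ltn_trans rr r8.
have [K [l [hK hl hlR]]] := halving_label_bits R r8.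
have [||d hd hs] := IH r.+1./2.
- by clear -hk r8; lia.
- by clear -r8; lia.
exists (l + (l + d))%N; last first.
  move=> m n F A B F_sign rr.
  by apply: (solvable_halving F_sign r0 hK hl) rr => A' B'; exact: hs.
have -> : maxn r 2 = r by apply/maxn_idPl; apply: leq_trans r8.
have sq : Num.sqrt (r.+1./2)%:R <= 3 / 4 * Num.sqrt r%:R :> R.
  have -> : 3 / 4 = Num.sqrt ((3 / 4) ^+ 2) :> R by rewrite sqrtr_sqr ger0_norm.
  rewrite -sqrtrM ?sqr_ge0 // ler_wsqrtr //.
  have : 16 * (r.+1./2)%:R <= 9 * r%:R :> R.
    by rewrite -!natrM ler_nat; clear -r8; lia.
  by lra.
have lnr : ln (maxn r.+1./2 2)%:R <= ln r%:R :> R.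
  rewrite ler_ln ?posrE ?ltr0n ?ler_nat ?leq_max ?orbT //.
  by clear -r8; lia.
have ln0 : 0 <= ln (maxn r.+1./2 2)%:R :> R by rewrite ln_ge0 // ler1n leq_max orbT.
have : Num.sqrt (r.+1./2)%:R * ln (maxn r.+1./2 2)%:R <= 3 / 4 * Num.sqrt r%:R * ln r%:R :> R.
  by rewrite ler_pM // sqrtr_ge0.
by rewrite !natrD; move: hd hlR; lra.
Qed.

(* [maxn r 2] only matters for r <= 1, where log r = 0 (or is undefined). *)
Theorem theorem1 (R : realType) :
  exists C : R,
    forall (X Y : finType) (f : X -> Y -> R) (r : nat),
      (forall (x : X) (y : Y), f x y = -1 \/ f x y = 1) ->
      \rank (fun_mx f) = r ->
      exists p : protocol X Y R,
        computes p f /\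
        (cost p)%:R <= C * (Num.sqrt r%:R * ln (maxn r 2)%:R).
Proof.
exists 5880 => X Y f r f_sign rE.
have F_sign i j : fun_mx f i j = -1 \/ fun_mx f i j = 1 by rewrite mxE.
have cost_le d (p : protocol X Y R) : (forall x y, (bits p x y <= d)%N) -> (cost p <= d)%N.
  by move=> h; apply/bigmax_leqP => x _; apply/bigmax_leqP.
have [r0|r0] := posnP r.
  (* A sign matrix of rank 0 has no entries, so there is no input pair to serve. *)
  have noXY (x : X) (y : Y) : False.
    move/eqP: rE; rewrite r0 mxrank_eq0 => /eqP/matrixP/(_ (enum_rank x) (enum_rank y)).
    rewrite !mxE => e; case: (f_sign (enum_val (enum_rank x)) (enum_val (enum_rank y))); rewrite e => /eqP;
      by rewrite ?(eq_sym 0) ?oppr_eq0 oner_eq0.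
  exists (Leaf (fun=> 0) (fun=> 0)); split; first by move=> x y; case: (noXY x y).
  have -> : cost (Leaf (fun=> 0) (fun=> 0) : protocol X Y R) = 0%N.
    by apply/eqP; rewrite -leqn0; apply: cost_le.
  by rewrite r0 sqrtr0 mul0r mulr0.
have [d hd hs] := solvable_of_rank R r0.
pose A : {set 'I_#|X|} := finset.setT; pose B : {set 'I_#|Y|} := finset.setT.
have maskT : mask (fun_mx f) A B = fun_mx f.
  by apply/matrixP => i j; rewrite mxE !finset.in_setT mulr1.
have [|p hp] := hs _ _ (fun_mx f) A B F_sign; first by rewrite maskT rE.
(* The protocol over ordinals is carried back to [X] and [Y] along their enumerations, with the same
   number of bits. *)
exists (precomp enum_rank enum_rank p).
have P x y := precompE enum_rank enum_rank p x y.
split=> [x y|].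
  rewrite (P x y).1; have [-> _] := hp (enum_rank x) (enum_rank y) (finset.in_setT _) (finset.in_setT _).
  by rewrite mxE !enum_rankK.
apply: le_trans hd; rewrite ler_nat; apply: cost_le => x y.
rewrite (P x y).2.
by have [] := hp (enum_rank x) (enum_rank y) (finset.in_setT _) (finset.in_setT _).
Qed.
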